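(* Let $\alpha\in(0,1)$, $n\in\mathbb N$, and let $\varphi_{(n)}$ be a multiple test procedure for $\mathcal H_n=\{H_1,\dots,H_n\}$ defined in terms of Simes' critical values $\alpha_{i:n}=i\alpha/n$, $i=1,\dots,n$. Let $\vartheta\in\Theta$ be such that $n_0$ of the hypotheses $H_1,\dots,H_n$ are true and the remaining ones are false. If (T1), (T2) and (D1) are satisfied, then $$\mathrm{FDR}_\vartheta(\varphi_{(n)})\le \frac{n_0}{n}\alpha,$$ with equality if $\varphi_{(n)}$ is a step-up test and (D3), (I1) and (I2) are satisfied in addition.
   Context: Let $(\mathcal X,\mathcal A,\{P_\vartheta:\vartheta\in\Theta\})$ be a statistical experiment, $(H_i)_{i\in\mathbb N}$ a sequence of null hypotheses with $\varnothing\neq H_i\subset\Theta$, and $(p_i)_{i\in\mathbb N}$ a sequence of $p$-values, i.e. measurable maps $p_i:\mathcal X\to[0,1]$ with $0<P_\vartheta(p_i\le x)\le x$ for all $\vartheta\in H_i$, $i\in\mathbb N$, $x\in(0,1]$. Put $\mathbb N_n=\{1,\dots,n\}$, $I_0(\vartheta)=\{i\in\mathbb N:\vartheta\in H_i\}$, $I_1(\vartheta)=\mathbb N\setminus I_0(\vartheta)$, $I_{n,j}(\vartheta)=I_j(\vartheta)\cap\mathbb N_n$, $n_j=|I_{n,j}(\vartheta)|$, $j=0,1$. $H_i$ is true under $\vartheta$ if $\vartheta\in H_i$. A (non-randomized) multiple test procedure is $\varphi_{(n)}=(\varphi_1,\dots,\varphi_n)$, a $\{0,1\}^n$-valued function of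 $p_1,\dots,p_n$, where $\varphi_i=1$ means that $H_i$ is rejected. $V_n=|\{i\in\mathbb N_n:\varphi_i=1,\ \vartheta\in H_i\}|$, $R_n=|\{i\in\mathbb N_n:\varphi_i=1\}|$, and $\mathrm{FDR}_\vartheta(\varphi_{(n)})=\mathbb E_\vartheta[V_n/(R_n\vee 1)]$. Conditions, for critical values $\alpha_{1:n}\le\dots\le\alpha_{n:n}$: (T1) For all $i\in\mathbb N_n$: $p_i\le\alpha_{1:n}$ implies $\varphi_i=1$. (T2) For all $j\in\mathbb N_n$: $R_n=j$ implies that for all $i\in\mathbb N_n$: $\varphi_i=1\Leftrightarrow p_i\le\alpha_{j:n}$. (D1) For all $\vartheta\in\Theta$, $j\in\mathbb N_n$, $i\in I_{n,0}(\vartheta)$: $P_\vartheta(R_n\ge j\mid p_i\le t)$ is nonincreasing in $t\in(0,\alpha_{j:n}]$. (D3) For all $\vartheta\in\Theta$ and $i\in I_{n,0}(\vartheta)$: $p_i$ is uniformly distributed on $[0,1]$ under $P_\vartheta$. (I1) For all $\vartheta\in\Theta$: the $p_i$, $i\in I_{n,0}(\vartheta)$, are i.i.d. under $P_\vartheta$. (I2) For all $\vartheta\in\Theta$: $(p_i:i\in I_{n,0}(\vartheta))$ and $(p_i:i\in I_{n,1}(\vartheta))$ are stochastically independent random vectors under $P_\vartheta$. The step-up test with critical values $\alpha_{1:n}\le\dots\le\alpha_{n:n}$ is: with ordered $p$-values $p_{1:n}\le\dots\le p_{n:n}$, let $m=\max\{j\in\mathbb N_n:p_{j:n}\le\alpha_{j:n}\}$;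 set $\varphi_i=1$ iff $p_i\le\alpha_{m:n}$ (no rejection if the set is empty). *)

(* Defs.v *)
From HB Require Import structures.
From mathcomp Require Import all_boot all_order all_algebra.
From mathcomp Require Import all_classical all_reals all_analysis.

Set Implicit Arguments.
Unset Strict Implicit.
Unset Printing Implicit Defensive.

Import Order.TTheory GRing.Theory Num.Theory.
Import numFieldNormedType.Exports.

Local Open Scope classical_set_scope.
Local Open Scope ring_scope.

(* Hypotheses and p-values are indexed from 0: [H i] and [p i] stand for the
   (i+1)-st hypothesis and p-value of the sequence, so ['I_n] plays the role of
   {1, ..., n}.  Critical values and rejection counts keep the usual indexing:
   [c j] is the j-th critical value, for 1 <= j <= n. *)

Section Probability.
Context {d : measure_display} {X : measurableType d} {R : realType}.
Implicit Types P : probability X R.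

Definition cprob P (A B : set X) : R := fine (P (A `&` B)) / fine (P B).

(* Equality of laws is only required on measurable sets: the value of a
   measure outside the sigma-algebra is arbitrary. *)
Definition uniform01 P (Y : {mfun X >-> R}) : Prop :=
  forall B : set R, measurable B ->
    distribution P Y B = uniform_prob (@ltr01 R) B.

Definition same_distribution P (Y Z : {mfun X >-> R}) : Prop :=
  forall B : set R, measurable B -> distribution P Y B = distribution P Z B.

Definition mutually_independent P (I : finType) (A : {set I})
    (Y : I -> {mfun X >-> R}) : Prop :=
  forall (J : {set I}) (B : I -> set R), J \subset A ->
    (forall i, measurable (B i)) ->
    P (\bigcap_(i in [set` J]) (Y i @^-1` B i)) =
    (\prod_(i in J) P (Y i @^-1` B i))%E.

Definition independent_elements P d1 d2 (T1 : measurableType d1)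
    (T2 : measurableType d2) (U : X -> T1) (V : X -> T2) : Prop :=
  forall (A : set T1) (B : set T2), measurable A -> measurable B ->
    P ((U @^-1` A) `&` (V @^-1` B)) =
    (P (U @^-1` A) * P (V @^-1` B))%E.

End Probability.

Section MultipleTests.
Context {d : measure_display} {X : measurableType d} {R : realType}.
Context {Theta : Type} (P : Theta -> probability X R).
Context (H : nat -> set Theta) (p : nat -> {mfun X >-> R}).

Definition is_pvalue (i : nat) : Prop :=
  (forall x, 0 <= p i x <= 1) /\
  (forall theta (t : R), H i theta -> 0 < t <= 1 ->
    (0 < P theta [set x | (p i x <= t)%R] <= t%:E)%E).

Definition true_nulls (n : nat) (theta : Theta) : {set 'I_n} :=
  [set i : 'I_n | `[< H i theta >]].

Definition pvec (n : nat) (x : X) : n.-tuple R := [tuple p i x | i < n].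

Definition psubvec (n : nat) (A : {set 'I_n}) (x : X) : #|A|.-tuple R :=
  [tuple p (enum_val k) x | k < #|A|].

Section Procedure.
Context (n : nat) (phi : {mfun n.-tuple R >-> n.-tuple bool}) (c : nat -> R).

Definition rejects (i : 'I_n) (x : X) : bool := tnth (phi (pvec n x)) i.

Definition num_rejections (x : X) : nat := #|[set i in 'I_n | rejects i x]|.

Definition num_false_rejections (theta : Theta) (x : X) : nat :=
  #|[set i in true_nulls n theta | rejects i x]|.

Definition FDR (theta : Theta) : \bar R :=
  'E_(P theta)[fun x => (num_false_rejections theta x)%:R
                        / (maxn (num_rejections x) 1)%:R].

Definition condT1 : Prop :=
  forall (x : X) (i : 'I_n), p i x <= c 1%N -> rejects i x.

Definition condT2 : Prop :=
  forall (x : X) (j : nat), (1 <= j <= n)%N -> num_rejections x = j ->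
    forall i : 'I_n, rejects i x <-> p i x <= c j.

Definition condD1 : Prop :=
  forall (theta : Theta) (j : nat) (i : 'I_n), (1 <= j <= n)%N ->
    i \in true_nulls n theta ->
    forall s t : R, 0 < s -> s <= t -> t <= c j ->
      cprob (P theta) [set x | (j <= num_rejections x)%N] [set x | p i x <= t]
      <= cprob (P theta) [set x | (j <= num_rejections x)%N]
           [set x | p i x <= s].

End Procedure.

Definition condD3 (n : nat) : Prop :=
  forall (theta : Theta) (i : 'I_n), i \in true_nulls n theta ->
    uniform01 (P theta) (p i).

Definition condI1 (n : nat) : Prop :=
  forall theta : Theta,
    mutually_independent (P theta) (true_nulls n theta)
      (fun i : 'I_n => p i) /\
    {in true_nulls n theta &, forall i j : 'I_n,
      same_distribution (P theta) (p i) (p j)}.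

Definition condI2 (n : nat) : Prop :=
  forall theta : Theta,
    independent_elements (P theta)
      (psubvec (true_nulls n theta)) (psubvec (~: true_nulls n theta)).

End MultipleTests.

Section StepUp.
Context {R : realType}.

(* [order_stat u j] is the j-th smallest entry of u, for 1 <= j <= n. *)
Definition order_stat n (u : n.-tuple R) (j : nat) : R :=
  nth 0 (sort <=%R u) j.-1.

(* The value 0 encodes that no j qualifies. *)
Definition step_up_index n (c : nat -> R) (u : n.-tuple R) : nat :=
  \max_(1 <= j < n.+1 | order_stat u j <= c j) j.

Definition step_up_test n (c : nat -> R) (u : n.-tuple R) : n.-tuple bool :=
  [tuple (0 < step_up_index c u)%N && (tnth u i <= c (step_up_index c u))
   | i < n].

Definition simes (alpha : R) (n j : nat) : R := j%:R * alpha / n%:R.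

End StepUp.

(* Only the values of the procedure at the observed p-values matter. *)
Definition is_step_up {d} {X : measurableType d} {R : realType}
    (p : nat -> {mfun X >-> R}) n
    (phi : {mfun n.-tuple R >-> n.-tuple bool}) (c : nat -> R) : Prop :=
  forall x : X, phi (pvec p n x) = step_up_test c (pvec p n x).

(* Main.v *)
Require Import Defs.
From mathcomp Require Import all_boot all_order all_algebra.
From mathcomp Require Import all_classical all_reals all_analysis.
From mathcomp Require Import measurable_realfun.

Local Open Scope classical_set_scope.
Local Open Scope ring_scope.

Import Order.TTheory GRing.Theory Num.Theory.
Import numFieldNormedType.Exports.

(** Write R for the number of rejections and c_j = j * alpha / n.  On the event
R = j >= 1, (T2) says that hypothesis i is rejected exactly when p_i <= c_j, so
that the false discovery rate is the sum over the true nulls i and over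
1 <= j <= n of

  j^-1 * P(p_i <= c_j, R = j)

([FDR_decomposition]).  It remains to compare, for each true null i, the inner
sum with alpha / n.

Upper bound ([sum_rejected_at_le]).  As P(p_i <= c_j) <= c_j = j * alpha / n,
the j-th term is at most

  alpha / n * (P(R >= j | p_i <= c_j) - P(R >= j + 1 | p_i <= c_j)).

By (D1) the subtracted probability only decreases when its condition is relaxed
to p_i <= c_(j+1).  The sum then telescopes to at most
alpha / n * P(R >= 1 | p_i <= c_1) <= alpha / n.

Equality for the step-up test ([sum_rejected_at_step_up]).  The number of
rejections of the step-up test is the last j at which #{k | p_k <= c_j} is still
at least j ([last_crossing]).  Let m be the same index once p_i has been
replaced by 0.  As long as p_i <= c_j, the events R = j and m = j agree
([last_crossing_leave_one_out]).  Now m does not involve p_i, hence is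
independent of it, so the j-th term is j^-1 * c_j * P(m = j) =
alpha / n * P(m = j).  Since m always lies between 1 and n, these terms add up
to alpha / n.

The independence of p_i and m is elementary, because m depends on the other
p-values only through the set of critical values that each of them does not
exceed.  It is thus a function of finitely many levels, whose joint events are
cylinders; on cylinders (I1) and (I2) give the product rule directly
([indep_levels]), and finite additivity does the rest. *)

(** * Last crossing of a counting function with the diagonal *)

(** The value is 0 when N stays strictly below the diagonal on 1, ..., n. *)
Definition last_crossing (n : nat) (N : nat -> nat) : nat :=
  \max_(1 <= j < n.+1 | (j <= N j)%N) j.

Lemma last_crossing_ge n N j : (1 <= j <= n)%N -> (j <= N j)%N ->
  (j <= last_crossing n N)%N.
Proof.
move=> jn jN; apply: (leq_bigmax_seq (F := id)) => //.
by rewrite mem_index_iota ltnS.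
Qed.

Lemma last_crossingP n N : (last_crossing n N <= n)%N /\
  (last_crossing n N <= N (last_crossing n N))%N.
Proof.
rewrite /last_crossing big_seq_cond.
apply: (big_ind (fun m => (m <= n)%N /\ (m <= N m)%N)) => //.
- by move=> a b; case: (leqP a b).
- by move=> j; rewrite mem_index_iota ltnS => /andP[/andP[_ ->] ->].
Qed.

Lemma eq_last_crossing n N N' : (forall j, (1 <= j <= n)%N -> N j = N' j) ->
  last_crossing n N = last_crossing n N'.
Proof.
move=> NN'; rewrite /last_crossing big_seq_cond [RHS]big_seq_cond.
apply: eq_bigl => j; rewrite mem_index_iota ltnS.
by case: (boolP (1 <= j <= n)%N) => //= /NN' ->.
Qed.

(** A nondecreasing N bounded by n cannot jump over the diagonal after its last
crossing: N m > m would make m + 1 another crossing. *)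
Lemma last_crossing_fixed n N : {homo N : j k / (j <= k)%N} ->
  (forall j, (N j <= n)%N) -> (0 < last_crossing n N)%N ->
  N (last_crossing n N) = last_crossing n N.
Proof.
move=> Nmono Nn m0; have [mn mN] := last_crossingP n N.
apply/eqP; rewrite eqn_leq mN andbT leqNgt; apply/negP => mN1.
suff : (last_crossing n N < last_crossing n N)%N by rewrite ltnn.
apply: last_crossing_ge; first by rewrite /= (leq_trans mN1).
exact: leq_trans mN1 (Nmono _ _ (leqnSn _)).
Qed.

Section CountBelow.
Context {R : realType} {n : nat} (c : nat -> R) (u : 'I_n -> R).

Definition count_below (A : {pred 'I_n}) (j : nat) : nat :=
  #|[pred k in A | u k <= c j]|.

Hypothesis c_mono : {homo c : j k / (j <= k)%N >-> j <= k}.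

Lemma count_below_mono A : {homo count_below A : j k / (j <= k)%N}.
Proof.
move=> j k jk; apply: subset_leq_card; apply/fintype.subsetP => l.
by rewrite !inE => /andP[-> /le_trans]; apply; exact: c_mono.
Qed.

(** The successor counts i unconditionally; for nonnegative c this amounts to
replacing u i by 0.  If u i <= c j, the counts at the indices l >= j are not
affected, so neither is the fact that j is the last crossing. *)
Lemma last_crossing_leave_one_out i j : (0 < j)%N -> u i <= c j ->
  (last_crossing n (count_below predT) == j) =
  (last_crossing n (fun l => (count_below (predC1 i) l).+1) == j).
Proof.
set N := count_below predT; set N' := fun l => _; move=> j0 uij.
have NE l : N l = ((u i <= c l)%R + count_below (predC1 i) l)%N.
  by rewrite /N /count_below (cardD1 i) !inE; congr (_ + _)%N.
have NN' l : (N l <= N' l)%N by rewrite NE -[N' l]add1n leq_add2r leq_b1.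
have NN'e l : (j <= l)%N -> N l = N' l.
  by move=> /c_mono cjl; rewrite NE (le_trans uij).
have [mn mN] := last_crossingP n N; have [mn' mN'] := last_crossingP n N'.
have le_mm' : (last_crossing n N <= last_crossing n N')%N.
  have [->//|m0] := posnP (last_crossing n N).
  by apply: last_crossing_ge; rewrite ?m0// (leq_trans mN).
have le_m'm : (j <= last_crossing n N')%N ->
    (last_crossing n N' <= last_crossing n N)%N.
  move=> jm'; apply: last_crossing_ge; first by rewrite mn' (leq_trans j0).
  by rewrite NN'e.
apply/eqP/eqP => mj; apply/eqP; rewrite eqn_leq.
- by rewrite -{1 2}mj le_mm' le_m'm// -mj.
- by rewrite -{1 2}mj le_mm' le_m'm// mj.
Qed.

End CountBelow.

(** * The step-up test in terms of counts *)

Section StepUp.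
Context {R : realType} {n : nat} (c : nat -> R) (u : n.-tuple R).

Lemma order_stat_le j y : (1 <= j <= n)%N ->
  (order_stat u j <= y) = (j <= #|[pred k | (tnth u k <= y)%R]|)%N.
Proof.
case: j => // j /= jn.
have -> : #|[pred k | tnth u k <= y]| = count (<= y) (sort <=%R u).
  rewrite (permP (permEl (perm_sort _ _))) -[X in _ = count _ X]map_tnth_enum.
  rewrite count_map cardE size_filter enumT; apply: eq_count => k.
  by rewrite inE.
have ss : sorted <=%R (sort <=%R u) by exact: sort_le_sorted.
apply/idP/idP => [|jc]; last exact: nth_count_le.
apply: contraTT; rewrite -leqNgt -ltNge => cj.
by apply: nth_count_gt => //; rewrite cj size_sort size_tuple.
Qed.

Lemma step_up_indexE :
  step_up_index c u = last_crossing n (count_below c (tnth u) predT).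
Proof.
rewrite /step_up_index /last_crossing big_seq_cond [RHS]big_seq_cond.
apply: eq_bigl => j; rewrite mem_index_iota ltnS.
by case: (boolP (1 <= j <= n)%N) => //= /order_stat_le ->.
Qed.

Hypothesis c_mono : {homo c : j k / (j <= k)%N >-> j <= k}.

Lemma card_step_up_test :
  #|[set i in 'I_n | tnth (step_up_test c u) i]| = step_up_index c u.
Proof.
rewrite step_up_indexE; set m := last_crossing _ _.
have [m0|m0] := posnP m.
  rewrite m0; apply/eqP; rewrite cards_eq0; apply/eqP/setP => i.
  by rewrite !inE tnth_mktuple step_up_indexE -/m m0.
rewrite -[RHS](@last_crossing_fixed n (count_below c (tnth u) predT))//.
- by apply: eq_card => i; rewrite !inE tnth_mktuple step_up_indexE -/m m0.
- exact: count_below_mono.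
- by move=> j; rewrite -[leqRHS]card_ord max_card.
Qed.

End StepUp.

(** * Events generated by a finitely valued map *)

Section FinitelyValued.
Context {d : measure_display} {X : measurableType d} {R : realType}.
Context (P : probability X R) {T : finType} (g : X -> T).
Hypothesis mg : forall t, measurable [set x | g x = t].

Lemma measurable_finitely_valued (Q : pred T) : measurable [set x | Q (g x)].
Proof.
have -> : [set x | Q (g x)] = \bigcup_(t in [set` Q]) [set x | g x = t].
  by apply/seteqP; split=> [x Qx|x [t Qt /= ->]//]; exists (g x).
by apply: fin_bigcup_measurable.
Qed.

Lemma measure_fibers (A : set X) : measurable A ->
  P A = (\sum_(t : T) P (A `&` [set x | g x = t]))%E.
Proof.
move=> mA.
have {1}-> : A = \bigcup_(t in [set` index_enum T]) (A `&` [set x | g x = t]).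
  apply/seteqP; split=> [x Ax|x [t _ []]//].
  by exists (g x) => //=; exact: mem_index_enum.
rewrite measure_fin_bigcup//.
- by rewrite -fsbig_seq// index_enum_uniq.
- by move=> s t _ _ [x [[_ <-] [_ <-]]].
- by move=> t _; exact: measurableI.
Qed.

Lemma measure_finitely_valued (Q : pred T) (A : set X) : measurable A ->
  P (A `&` [set x | Q (g x)]) =
  (\sum_(t | Q t) P (A `&` [set x | g x = t]))%E.
Proof.
move=> mA; rewrite measure_fibers; last first.
  by apply: measurableI => //; exact: measurable_finitely_valued.
rewrite [RHS]big_mkcond; apply: eq_bigr => t _; case: ifPn => Qt.
  congr (P _); apply/seteqP; split=> x /=; first by case=> -[].
  by case=> ? gx; rewrite gx.
rewrite -[RHS](measure0 P); congr (P _); rewrite -subset0 => x /= -[[_ Qx] gx].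
by move: Qt; rewrite -gx Qx.
Qed.

(** Finite additivity replaces the usual Dynkin argument here: independence of
the fibers of g suffices for all the events that g generates. *)
Lemma indep_finitely_valued (A : set X) : measurable A ->
  (forall t, P (A `&` [set x | g x = t]) = P A * P [set x | g x = t])%E ->
  forall Q : pred T,
    (P (A `&` [set x | Q (g x)]) = P A * P [set x | Q (g x)])%E.
Proof.
move=> mA indA Q; rewrite measure_finitely_valued//.
rewrite -[X in (_ * P X)%E]setTI measure_finitely_valued//.
rewrite ge0_sume_distrr//; apply: eq_bigr => t _.
by rewrite setTI indA.
Qed.

End FinitelyValued.

(** * Uniform p-values *)

Section Uniform.
Context {R : realType}.

Lemma measurable_le_set (t : R) : measurable [set y : R | y <= t].
Proof.
have -> : [set y : R | y <= t] = `]-oo, t]%classic.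
  by apply/seteqP; split=> y /=; rewrite in_itv.
exact: measurable_itv.
Qed.

Lemma uniform_prob_le (t : R) : 0 <= t <= 1 ->
  uniform_prob (@ltr01 R) [set y | y <= t] = t%:E.
Proof.
move=> /andP[t0 t1]; rewrite /uniform_prob integral_uniform_pdf.
have -> : [set y : R | y <= t] `&` `[0, 1]%classic = `[0, t]%classic.
  apply/seteqP; split=> y /=; rewrite !in_itv/=.
    by move=> [-> /andP[->]].
  by move=> /andP[-> yt]; split=> //; exact: le_trans t1.
rewrite (eq_integral (fun=> 1%E)); last first.
  move=> y; rewrite inE/= in_itv/= => /andP[y0 yt].
  by rewrite /uniform_pdf y0 (le_trans yt t1) subr0 invr1.
rewrite integral_cst//= mul1e lebesgue_measure_itv/= lte_fin.
by case: ltgtP t0 => // [_ _|<- _]; rewrite ?sube0.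
Qed.

End Uniform.

(** * Independence of a true null p-value from the other p-values *)

Section Independence.
Context {d : measure_display} {X : measurableType d} {R : realType}.
Context (P : probability X R) (p : nat -> {mfun X >-> R}) (n : nat).
Context (A : {set 'I_n}).
Hypothesis indA : mutually_independent P A (fun i : 'I_n => p i).
Hypothesis indAC : independent_elements P (psubvec p A) (psubvec p (~: A)).

(** The coordinates in A are independent of each other and, as a block, of the
remaining ones, which may depend on each other arbitrarily. *)
Lemma prob_cylinder (B : 'I_n -> set R) : (forall k, measurable (B k)) ->
  P (\bigcap_(k : 'I_n) (p k @^-1` B k)) =
  (\prod_(k in A) P (p k @^-1` B k) *
   P (\bigcap_(k in [set` ~: A]) (p k @^-1` B k)))%E.
Proof.
move=> mB.
pose C (S : {set 'I_n}) : set (#|S|.-tuple R) :=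
  \bigcap_(k : 'I_#|S|) ((@tnth _ R ^~ k) @^-1` B (enum_val k)).
have mC S : measurable (C S).
  apply: fin_bigcap_measurable => // k _; rewrite -[X in measurable X]setTI.
  exact: measurable_tnth.
have CE S : psubvec p S @^-1` C S = \bigcap_(k in [set` S]) (p k @^-1` B k).
  apply/seteqP; split=> x Sx k /= kS.
    by have := Sx (enum_rank_in kS k) I; rewrite /= tnth_mktuple enum_rankK_in.
  by rewrite /= tnth_mktuple; apply: Sx; exact: enum_valP.
rewrite -(indA A B (subxx A) mB) -(CE A) -(CE (~: A)).
rewrite -(indAC _ _ (mC _) (mC _)) (CE A) (CE (~: A)) -bigcap_setU.
congr (P (\bigcap_(k in _) _)); apply/seteqP; split=> // k _ /=.
by rewrite !inE; case: (k \in A); [left|right].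
Qed.

Lemma prob_cylinder_split (i : 'I_n) (B : 'I_n -> set R) : i \in A ->
  (forall k, measurable (B k)) ->
  P (p i @^-1` B i `&` \bigcap_(k in [set k | k != i]) (p k @^-1` B k)) =
  (P (p i @^-1` B i) * P (\bigcap_(k in [set k | k != i]) (p k @^-1` B k)))%E.
Proof.
move=> iA mB.
(* Dropping the constraint on coordinate i turns both sides into cylinders over
   all the coordinates. *)
pose B' k := if k == i then setT else B k.
have mB' k : measurable (B' k) by rewrite /B'; case: ifP.
have -> : \bigcap_(k in [set k | k != i]) (p k @^-1` B k) =
    \bigcap_(k : 'I_n) (p k @^-1` B' k).
  apply/seteqP; split=> x /= Bx k; rewrite /= /B'.
    by move=> _; case: eqVneq => // ki; exact: Bx.
  by move=> /negbTE ki; have := Bx k I; rewrite /= /B' ki.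
have -> : p i @^-1` B i `&` \bigcap_(k : 'I_n) (p k @^-1` B' k) =
    \bigcap_(k : 'I_n) (p k @^-1` B k).
  apply/seteqP; split=> x /=.
    move=> [Bi Bx] k _; have := Bx k I; rewrite /= /B'.
    by case: eqVneq => // ->.
  move=> Bx; split=> [|k _]; first exact: Bx.
  by rewrite /= /B'; case: eqP => // _; exact: Bx.
rewrite !prob_cylinder// (bigD1 i)//= [X in (_ = _ * (X * _))%E](bigD1 i)//=.
have -> : B' i = setT by rewrite /B' eqxx.
rewrite preimage_setT probability_setT mul1e muleA.
congr (_ * _ * P _)%E.
  by apply: eq_bigr => k /andP[_ /negbTE ki]; rewrite /B' ki.
apply: eq_bigcapr => k; rewrite /= inE /B'.
by case: eqVneq => // ->; rewrite iA.
Qed.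

Lemma measurable_preimage (k : nat) (D : set R) :
  measurable D -> measurable (p k @^-1` D).
Proof.
by move=> mD; rewrite -[X in measurable X]setTI; exact: measurable_funP.
Qed.

Section Levels.
Context (i : 'I_n) {T : finType} (f : R -> T) (t0 : T).
Hypothesis mf : forall t, measurable [set y | f y = t].

(** Coordinate i is overwritten by the constant t0, so that every function of
the levels is a function of the other coordinates. *)
Definition levels (x : X) : {ffun 'I_n -> T} :=
  [ffun k => if k == i then t0 else f (p k x)].

Lemma levels_fiberE (L : {ffun 'I_n -> T}) : [set x | levels x = L] =
  if L i == t0
  then \bigcap_(k in [set k | k != i]) (p k @^-1` [set y | f y = L k])
  else set0.
Proof.
apply/seteqP; split=> [x /= <-|].
  rewrite ffunE eqxx eqxx => k /= /negbTE ki.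
  by rewrite ffunE ki.
case: eqP => [Li|_]; last exact: sub0set.
move=> x Lx /=; apply/ffunP => k; rewrite ffunE.
by case: eqVneq => [->//|ki]; exact: Lx.
Qed.

Lemma measurable_levels L : measurable [set x | levels x = L].
Proof.
rewrite levels_fiberE; case: ifP => // _.
apply: fin_bigcap_measurable => [|k _]; first exact: finite_finset.
exact: measurable_preimage.
Qed.

Lemma indep_levels (B : set R) (Q : pred {ffun 'I_n -> T}) :
  i \in A -> measurable B ->
  P (p i @^-1` B `&` [set x | Q (levels x)]) =
  (P (p i @^-1` B) * P [set x | Q (levels x)])%E.
Proof.
move=> iA mB.
apply: (indep_finitely_valued P _ measurable_levels) => [|L].
  exact: measurable_preimage.
rewrite levels_fiberE; case: ifP => _; last by rewrite setI0 measure0 mule0.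
pose D k := if k == i then B else [set y | f y = L k].
have -> : \bigcap_(k in [set k | k != i]) (p k @^-1` [set y | f y = L k]) =
    \bigcap_(k in [set k | k != i]) (p k @^-1` D k).
  by apply: eq_bigcapr => k /= /negbTE ki; rewrite /D ki.
have {1 2}-> : B = D i by rewrite /D eqxx.
by apply: prob_cylinder_split => // k; rewrite /D; case: ifP.
Qed.

End Levels.

End Independence.

(** * The false discovery rate as a sum of probabilities *)

Lemma expectation_sum_indic {d} {X : measurableType d} {R : realType}
    (P : probability X R) (I : finType) (Q : pred I) (a : I -> R)
    (E : I -> set X) :
  (forall i, 0 <= a i) -> (forall i, measurable (E i)) ->
  'E_P[fun x => (\sum_(i | Q i) a i * \1_(E i) x)%R]%E =
  (\sum_(i | Q i) a i * fine (P (E i)))%:E.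
Proof.
move=> a0 mE; rewrite unlock.
under eq_integral do rewrite -big_filter -sumEFin.
rewrite ge0_integral_sum//; last 2 first.
- move=> i; apply/measurable_EFinP; exact: measurable_funM.
- by move=> i x _; rewrite lee_fin mulr_ge0.
rewrite big_filter -sumEFin; apply: eq_bigr => i _.
under eq_integral do rewrite EFinM.
rewrite ge0_integralZl//; last 2 first.
- exact/measurable_EFinP.
- by rewrite lee_fin.
by rewrite integral_indic// setIT EFinM fineK// fin_num_measure.
Qed.

Section Procedure.
Context {d : measure_display} {X : measurableType d} {R : realType}.
Context {Theta : Type} (P : Theta -> probability X R) (H : nat -> set Theta).
Context (p : nat -> {mfun X >-> R}) (n : nat).
Context (phi : {mfun n.-tuple R >-> n.-tuple bool}) (c : nat -> R).

Lemma measurable_pvec : measurable_fun [set: X] (pvec p n).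
Proof.
apply/measurable_fun_tnthP => i.
rewrite (_ : _ \o _ = p i); first exact: measurable_funP.
by apply/funext => x /=; rewrite tnth_mktuple.
Qed.

Lemma measurable_decision (t : n.-tuple bool) :
  measurable [set x | phi (pvec p n x) = t].
Proof.
have mphi : measurable_fun [set: X] (phi \o pvec p n).
  by apply: measurableT_comp => //; exact: measurable_pvec.
have -> : [set x | phi (pvec p n x) = t] =
    \bigcap_(i : 'I_n)
      (fun x => tnth (phi (pvec p n x)) i) @^-1` [set tnth t i].
  apply/seteqP; split=> x /=; first by move=> <- i _.
  by move=> tx; apply: eq_from_tnth => i; exact: tx.
apply: fin_bigcap_measurable => [|i _]; first exact: finite_finset.
rewrite -[X in measurable X]setTI.
by move/measurable_fun_tnthP : mphi => /(_ i); exact.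
Qed.

Lemma measurable_num_rejections (Q : pred nat) :
  measurable [set x | Q (num_rejections p phi x)].
Proof.
exact: (measurable_finitely_valued _ measurable_decision
  (fun t => Q #|[set i in 'I_n | tnth t i]|)).
Qed.

Lemma measurable_pvalue_le i (t : R) : measurable [set x | p i x <= t].
Proof.
exact: (measurable_preimage p i _ (measurable_le_set t)).
Qed.

Definition rejected_at (i j : nat) : set X :=
  [set x | p i x <= c j] `&` [set x | num_rejections p phi x == j].

Lemma measurable_rejected_at i j : measurable (rejected_at i j).
Proof.
apply: measurableI; first exact: measurable_pvalue_le.
exact: (measurable_num_rejections (pred1 j)).
Qed.

(** Only the term at j + 1 = R can be nonzero, and there is none if nothing is
rejected. *)
Lemma rejects_rejected_at (i : 'I_n) (x : X) : condT2 p phi c ->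
  (rejects p phi i x)%:R / (maxn (num_rejections p phi x) 1)%:R =
  \sum_(j < n) j.+1%:R^-1 * \1_(rejected_at i j.+1) x :> R.
Proof.
move=> hT2; set r := num_rejections p phi x.
have rn : (r <= n)%N by rewrite -[leqRHS]card_ord max_card.
have indE (j : nat) :
    \1_(rejected_at i j) x = ((p i x <= c j) && (r == j))%:R :> R.
  rewrite indicE; congr (nat_of_bool _)%:R.
  by apply/idP/idP => [/set_mem[/= -> ->]//|/andP[? ?]]; exact/mem_set.
under eq_bigr do rewrite indE.
have [r0|r0] := posnP r.
  rewrite big1 => [|j _]; last by rewrite r0 andbF mulr0.
  have -> : rejects p phi i x = false; last by rewrite mul0r.
  apply/negP => rej; move/eqP : r0; apply/negP; rewrite -lt0n card_gt0.
  by apply/set0Pn; exists i; rewrite !inE.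
have r1n : (r.-1 < n)%N by rewrite prednK.
rewrite (bigD1 (Ordinal r1n))//= prednK// eqxx andbT big1 => [|j /eqP jr].
  rewrite addr0 (maxn_idPl r0) mulrC; congr (_ * (nat_of_bool _)%:R).
  by apply/idP/idP => /hT2; apply; rewrite // r0.
have /negbTE -> : r != j.+1.
  by apply/eqP => rj; apply: jr; apply: val_inj; rewrite /= rj.
by rewrite andbF mulr0.
Qed.

Lemma FDR_decomposition theta : condT2 p phi c ->
  FDR P H p phi theta =
  (\sum_(i in true_nulls H n theta) \sum_(j < n)
     j.+1%:R^-1 * fine (P theta (rejected_at i j.+1)))%:E.
Proof.
move=> hT2; pose nulls := true_nulls H n theta.
transitivity (\sum_(z : 'I_n * 'I_n | z.1 \in nulls)
    z.2.+1%:R^-1 * fine (P theta (rejected_at z.1 z.2.+1)))%:E; last first.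
  by rewrite pair_big; congr EFin; apply: eq_bigl => z; rewrite andbT.
rewrite -(expectation_sum_indic (P theta) _ _
  (fun z : 'I_n * 'I_n => z.2.+1%:R^-1)
  (fun z : 'I_n * 'I_n => rejected_at z.1 z.2.+1))//; last first.
  by move=> z; exact: measurable_rejected_at.
congr ('E_(P theta)[_]%E); apply/funext => x.
transitivity (\sum_(i in nulls) \sum_(j < n)
    j.+1%:R^-1 * \1_(rejected_at i j.+1) x : R); last first.
  by rewrite pair_big; apply: eq_bigl => z; rewrite andbT.
under eq_bigr do rewrite -rejects_rejected_at//.
rewrite -mulr_suml -natr_sum; congr (_%:R / _).
rewrite /num_false_rejections -sum1_card big_mkcond [RHS]big_mkcond.
by apply: eq_bigr => i _; rewrite !inE; case: asbool => //=; case: rejects.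
Qed.

End Procedure.

(** * Simes' critical values *)

Section Simes.
Context {R : realType} (alpha : R) (n : nat).
Hypothesis halpha : 0 < alpha < 1.
Hypothesis hn : (0 < n)%N.

Lemma simesE j : simes alpha n j = j%:R * (alpha / n%:R).
Proof. by rewrite /simes mulrA. Qed.

Lemma simes_slope_gt0 : 0 < alpha / n%:R.
Proof. by rewrite divr_gt0 ?ltr0n//; case/andP: halpha. Qed.

Lemma simes_mono : {homo simes alpha n : j k / (j <= k)%N >-> j <= k}.
Proof.
by move=> j k jk; rewrite !simesE ler_wpM2r ?ler_nat// ltW// simes_slope_gt0.
Qed.

Lemma simes_itv j : (1 <= j <= n)%N -> 0 < simes alpha n j <= 1.
Proof.
move=> /andP[j0 jn]; rewrite simesE mulr_gt0 ?simes_slope_gt0 ?ltr0n//=.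
rewrite mulrCA mulr_ile1 ?divr_ge0 ?(ltW (proj1 (andP halpha)))//.
  by case/andP: halpha => _ /ltW.
by rewrite ler_pdivrMr ?ltr0n// mul1r ler_nat.
Qed.

End Simes.

(** * Contribution of a single true null *)

Section PerHypothesis.
Context {d : measure_display} {X : measurableType d} {R : realType}.
Context {Theta : Type} (P : Theta -> probability X R) (H : nat -> set Theta).
Context (p : nat -> {mfun X >-> R}) (n : nat).
Context (phi : {mfun n.-tuple R >-> n.-tuple bool}) (alpha : R).
Context (theta : Theta) (i : 'I_n).
Hypothesis halpha : 0 < alpha < 1.
Hypothesis hn : (0 < n)%N.
Hypothesis inull : i \in true_nulls H n theta.
Let c := simes alpha n.
Let r := num_rejections p phi.
Let Pr (A : set X) : R := fine (P theta A).

(** The contributions are bounded by a telescoping sum: (D1) lets the conditions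
of consecutive tail probabilities be matched, and Simes' critical values make
the factor P(p_i <= c_j) / j at most alpha / n. *)
Lemma sum_rejected_at_le : is_pvalue P H p i -> condD1 P H p phi c ->
  \sum_(j < n) j.+1%:R^-1 * Pr (rejected_at p n phi c i j.+1) <= alpha / n%:R.
Proof.
move=> [_ hp] hD1.
have Hi : H i theta by move: inull; rewrite inE => /asboolP.
have mr k : measurable [set x | (k <= r x)%N].
  exact: (measurable_num_rejections p n phi (leq k)).
have mp t : measurable [set x | p i x <= t] by exact: measurable_pvalue_le.
have Pfin A : measurable A -> P theta A \is a fin_num.
  by move=> mA; exact: fin_num_measure.
have Pr_ge0 A : 0 <= Pr A by exact: fine_ge0.
have Pr_le A B : measurable A -> measurable B -> A `<=` B -> Pr A <= Pr B.
  move=> mA mB AB; apply: fine_le; rewrite ?Pfin//.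
  by apply: le_measure; rewrite ?inE.
pose tail k t := cprob (P theta) [set x | (k <= r x)%N] [set x | p i x <= t].
(* At k = n + 1 the tail event is empty, so beta vanishes there. *)
pose beta k := tail k (c k).
have r_le x : (r x <= n)%N by rewrite -[leqRHS]card_ord max_card.
have tail0 t : tail n.+1 t = 0.
  rewrite /tail /cprob (_ : _ `&` _ = set0) ?measure0 ?mul0r//.
  by rewrite -subset0 => x /= -[+ _]; rewrite ltnNge r_le.
have beta1 : beta 1%N <= 1.
  rewrite /beta /tail /cprob -/(Pr _) -/(Pr _).
  have [->|nz] := eqVneq (Pr [set x | p i x <= c 1%N]) 0.
    by rewrite invr0 mulr0.
  have Pgt0 : 0 < Pr [set x | p i x <= c 1%N].
    by rewrite lt_neqAle eq_sym nz Pr_ge0.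
  by rewrite ler_pdivrMr// mul1r; apply: Pr_le => //; exact: measurableI.
have step j : (j < n)%N ->
    j.+1%:R^-1 * Pr (rejected_at p n phi c i j.+1) <=
    alpha / n%:R * (beta j.+1 - beta j.+2).
  move=> jn; set A := [set x | p i x <= c j.+1].
  have /(hp _ _ Hi)/andP[PA0 PAle] : 0 < c j.+1 <= 1 by apply: simes_itv.
  have PA_gt0 : 0 < Pr A by rewrite fine_gt0// PA0/= (le_lt_trans PAle)// ltry.
  have {PAle}PA_le : Pr A <= j.+1%:R * (alpha / n%:R).
    by rewrite -simesE -lee_fin (fineK (Pfin A (mp _))); exact: PAle.
  have mrej : measurable (rejected_at p n phi c i j.+1).
    exact: measurable_rejected_at.
  have mtail : measurable ([set x | (j.+1 < r x)%N] `&` A).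
    by apply: measurableI; [exact: mr|exact: mp].
  have PrD : Pr ([set x | (j < r x)%N] `&` A) =
      Pr (rejected_at p n phi c i j.+1) + Pr ([set x | (j.+1 < r x)%N] `&` A).
    rewrite /Pr -fineD ?Pfin// -measureU//.
      congr (fine (P theta _)); apply/seteqP; split=> x /=.
        move=> [+ px]; rewrite leq_eqVlt => /orP[jr|jr]; [left|by right].
        by split=> //=; rewrite eq_sym.
      move=> [[px /eqP rx]|[/ltnW jr px]]; split=> //.
      by rewrite -/(r x) in rx; rewrite rx.
    rewrite -subset0 => x [[_ /= /eqP rx] [/=]].
    by rewrite -/(r x) in rx; rewrite rx ltnn.
  have tail_split : Pr (rejected_at p n phi c i j.+1) =
      Pr A * (beta j.+1 - tail j.+2 (c j.+1)).
    rewrite /beta /tail /cprob -/A -!/(Pr _) mulrBr !(mulrC (Pr A)).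
    by rewrite !divfK ?gt_eqF// PrD addrK.
  (* (D1) applies when j + 2 <= n; otherwise both sides vanish. *)
  have tail_le : beta j.+2 <= tail j.+2 (c j.+1).
    move: (jn); rewrite leq_eqVlt => /orP[/eqP->|j1n].
      by rewrite /beta !tail0.
    have /andP[cj0 _] : 0 < c j.+1 <= 1 by apply: simes_itv.
    by apply: hD1 => //; exact: simes_mono.
  have ge0 : 0 <= beta j.+1 - tail j.+2 (c j.+1).
    by rewrite -(pmulr_rge0 _ PA_gt0) -tail_split.
  rewrite tail_split mulrA.
  apply: (@le_trans _ _ (alpha / n%:R * (beta j.+1 - tail j.+2 (c j.+1)))).
    by rewrite ler_wpM2r// mulrC ler_pdivrMr ?ltr0n// mulrC.
  by rewrite ler_wpM2l ?(ltW (simes_slope_gt0 _ _ halpha hn))// lerB.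
apply: (@le_trans _ _ (\sum_(j < n) alpha / n%:R * (beta j.+1 - beta j.+2))).
  by apply: ler_sum => j _; exact: step.
rewrite -mulr_sumr -[leRHS]mulr1.
rewrite ler_wpM2l ?(ltW (simes_slope_gt0 _ _ halpha hn))//.
under eq_bigr do rewrite -opprB.
rewrite sumrN -(big_mkord xpredT (fun j => beta j.+2 - beta j.+1)).
rewrite (telescope_sumr (fun j => beta j.+1))// opprB.
by rewrite /(beta n.+1) tail0 subr0.
Qed.

(** The number of rejections that the step-up test would make if p_i were 0. *)
Definition loo_rejections (x : X) : nat :=
  last_crossing n
    (fun j => (count_below c (fun k : 'I_n => p k x) (predC1 i) j).+1).

Lemma loo_rejections_itv x : (0 < loo_rejections x <= n)%N.
Proof.
rewrite /loo_rejections; set N := fun j => _.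
by rewrite (proj1 (last_crossingP n N)) andbT; exact: last_crossing_ge.
Qed.

Lemma rejected_at_loo j : is_step_up p phi c ->
  rejected_at p n phi c i j.+1 =
  [set x | p i x <= c j.+1] `&` [set x | loo_rejections x == j.+1].
Proof.
move=> hsu.
have rE x : p i x <= c j.+1 -> (r x == j.+1) = (loo_rejections x == j.+1).
  move=> pc.
  rewrite -(last_crossing_leave_one_out _ _ (simes_mono _ _ halpha hn) i)//.
  rewrite /r /num_rejections /rejects hsu card_step_up_test; last first.
    exact: simes_mono.
  rewrite step_up_indexE; congr (last_crossing _ _ == _).
  by apply/funext => k; apply: eq_card => l; rewrite !inE tnth_mktuple.
apply/seteqP; split=> x /= -[pc rm]; split=> //=; first by rewrite -rE.
by move: rm; rewrite -rE.
Qed.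

(** The position of y relative to the critical values.  Index 0 is a placeholder
that lets the critical values keep their numbering from 1. *)
Let level (y : R) : {set 'I_n.+1} := [set j : 'I_n.+1 | y <= c j]%SET.

Let measurable_level S : measurable [set y : R | level y = S].
Proof.
have -> : [set y : R | level y = S] =
    \bigcap_(j : 'I_n.+1) [set y | (y <= c j) = (j \in S)].
  apply/seteqP; split=> y /=; first by move=> <- j _ /=; rewrite /level inE.
  by move=> yS; apply/setP => j; rewrite /level inE; exact: yS.
apply: fin_bigcap_measurable => [|j _]; first exact: finite_finset.
case: (j \in S); first exact: measurable_le_set.
have -> : [set y | (y <= c j) = false] = ~` [set y | y <= c j].
  by apply/seteqP; split=> y /= => [->//|/negP/negbTE].
by apply: measurableC; exact: measurable_le_set.
Qed.

Let others := levels p n i level finset.set0.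

Let loo_eq (j : nat) (L : {ffun 'I_n -> {set 'I_n.+1}}) : bool :=
  last_crossing n (fun l => #|[pred k | k != i & inord l \in L k]|.+1) == j.

Let loo_rejectionsE j :
  [set x | loo_rejections x == j] = [set x | loo_eq j (others x)].
Proof.
apply/funext => x /=; congr (is_true (_ == _)).
apply: eq_last_crossing => l /andP[_ ln]; congr S; apply: eq_card => k.
rewrite !inE ffunE; case: eqVneq => //= _.
by rewrite /level inE inordK.
Qed.

Lemma measurable_loo_rejections j : measurable [set x | loo_rejections x == j].
Proof.
rewrite loo_rejectionsE; apply: measurable_finitely_valued => L.
exact: measurable_levels.
Qed.

Lemma indep_loo_rejections j t : condI1 P H p n -> condI2 P H p n ->
  P theta ([set x | p i x <= t] `&` [set x | loo_rejections x == j]) =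
  (P theta [set x | (p i x <= t)%R] *
   P theta [set x | loo_rejections x == j])%E.
Proof.
move=> hI1 hI2; rewrite loo_rejectionsE.
apply: (indep_levels _ _ _ _ (proj1 (hI1 theta)) (hI2 theta) i level finset.set0
  measurable_level [set y | y <= t] (loo_eq j)) => //.
exact: measurable_le_set.
Qed.

Lemma sum_loo_rejections :
  \sum_(j < n) Pr [set x | loo_rejections x == j.+1] = 1.
Proof.
have loo_lt x : ((loo_rejections x).-1 < n)%N.
  by have /andP[m0 mn] := loo_rejections_itv x; rewrite prednK.
pose loo_ord x := Ordinal (loo_lt x).
have looE (j : 'I_n) :
    [set x | loo_ord x = j] = [set x | loo_rejections x == j.+1].
  apply/seteqP; split=> x /=.
    by move=> <- /=; rewrite prednK//; case/andP: (loo_rejections_itv x).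
  by move=> /eqP mj; apply: val_inj; rewrite /= mj.
apply: EFin_inj; rewrite -sumEFin -(@probability_setT _ _ _ (P theta)).
rewrite (measure_fibers (P theta) loo_ord) => [|j|//]; last first.
  by rewrite looE; exact: measurable_loo_rejections.
apply: eq_bigr => j _; rewrite setTI looE /Pr fineK// fin_num_measure//.
exact: measurable_loo_rejections.
Qed.

(** By independence and uniformity the j-th contribution is alpha / n times the
probability that j hypotheses are rejected once p_i is set to 0. *)
Lemma sum_rejected_at_step_up : is_step_up p phi c -> condD3 P H p n ->
  condI1 P H p n -> condI2 P H p n ->
  \sum_(j < n) j.+1%:R^-1 * Pr (rejected_at p n phi c i j.+1) = alpha / n%:R.
Proof.
move=> hsu hD3 hI1 hI2.
rewrite -[RHS]mulr1 -[X in _ = _ * X]sum_loo_rejections mulr_sumr.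
apply: eq_bigr => j _.
rewrite rejected_at_loo// /Pr indep_loo_rejections//.
have /andP[cj0 cj1] : 0 < c j.+1 <= 1.
  by apply: simes_itv => //; exact: ltn_ord.
have -> : P theta [set x | p i x <= c j.+1] = (c j.+1)%:E.
  rewrite -uniform_prob_le ?(ltW cj0)//; apply: (hD3 _ _ inull).
  exact: measurable_le_set.
rewrite fineM//=; last first.
  by rewrite fin_num_measure//; exact: measurable_loo_rejections.
by rewrite /c simesE !mulrA mulVf ?mul1r// pnatr_eq0.
Qed.

End PerHypothesis.

Theorem theorem4p1 (R : realType) (d : measure_display) (X : measurableType d)
  (Theta : Type) (P : Theta -> probability X R)
  (H : nat -> set Theta) (hH : forall i, H i !=set0)
  (p : nat -> {mfun X >-> R}) (hp : forall i, is_pvalue P H p i)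
  (alpha : R) (halpha : 0 < alpha < 1)
  (n : nat) (hn : (0 < n)%N)
  (phi : {mfun n.-tuple R >-> n.-tuple bool})
  (theta : Theta) (n0 : nat) (hn0 : #|true_nulls H n theta| = n0)
  (hT1 : condT1 p phi (simes alpha n))
  (hT2 : condT2 p phi (simes alpha n))
  (hD1 : condD1 P H p phi (simes alpha n)) :
  (FDR P H p phi theta <= (n0%:R / n%:R * alpha)%:E)%E /\
  (is_step_up p phi (simes alpha n) ->
   condD3 P H p n -> condI1 P H p n -> condI2 P H p n ->
   FDR P H p phi theta = (n0%:R / n%:R * alpha)%:E).
Proof.
have -> : n0%:R / n%:R * alpha =
    \sum_(i in true_nulls H n theta) alpha / n%:R :> R.
  by rewrite sumr_const hn0 -[RHS]mulr_natl -mulrA [_^-1 * _]mulrC.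
rewrite (FDR_decomposition _ _ _ _ _ _ _ hT2); split=> [|hsu hD3 hI1 hI2].
  rewrite lee_fin; apply: ler_sum => i inull.
  exact: sum_rejected_at_le halpha hn inull (hp i) hD1.
congr EFin; apply: eq_bigr => i inull.
exact: sum_rejected_at_step_up halpha hn inull hsu hD3 hI1 hI2.
Qed.
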